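(* Let $L_0,v_0,h_0,w_{m_0}$ be positive constants with $v_0>w_{m_0}$, and let $\varepsilon=0$ or $\varepsilon=1$. There exists a unique similarity solution $(w^\varepsilon,s^\varepsilon)$ to the problem $$w_{zz}=w_t,\quad 0<z<s(t),\ t>0;\qquad w_z(s(t),t)=-L_0\sqrt t\,s'(t),\quad t>0;$$ $$w(s(t),t)=2w_{m_0}\sqrt t,\quad t>0;\qquad w_z(0,t)=\frac{h_0}{\sqrt t}\left(\varepsilon w(0,t)-2v_0\sqrt t\right),\quad t>0;\qquad s(0)=0,$$ and it is given by $$w^{\varepsilon}(z,t)=\frac{2\sqrt t\,(2h_0v_0-L_0\gamma^{\varepsilon})}{\sqrt\pi\,\mathrm{erf}(\gamma^{\varepsilon})+2h_0\varepsilon}\left[\exp\left(-\frac{z^2}{4t}\right)+\frac{z\sqrt\pi}{2\sqrt t}\,\mathrm{erf}\left(\frac{z}{2\sqrt t}\right)\right]-z\left[\frac{2L_0\gamma^\varepsilon h_0\varepsilon+2h_0v_0\sqrt\pi\,\mathrm{erf}(\gamma^\varepsilon)}{\sqrt\pi\,\mathrm{erf}(\gamma^\varepsilon)+2h_0\varepsilon}\right]$$ for $0\le z\le s^\varepsilon(t)$, $t>0$, and $$s^{\varepsilon}(t)=2\gamma^{\varepsilon}\sqrt t,\qquad t>0,$$ where $\gamma^\varepsilon$ is the unique solution to $$(2v_0h_0-L_0\gamma)\exp(-\gamma^2)=(w_{m_0}+L_0\gamma^2)\left[\sqrt\pi\,\mathrm{erf}(\gamma)+2h_0\varepsilon\right],\qquad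 \gamma>0.$$
   Context: $\mathrm{erf}(x)=\frac{2}{\sqrt\pi}\int_0^x e^{-u^2}\,du$. A similarity solution is a solution $(w,s)$ of the form $w(z,t)=2\sqrt t\,T(\eta)$ with $\eta=\frac{z}{2\sqrt t}$ for some function $T$ of one variable, and $s(t)=2\gamma\sqrt t$ for some constant $\gamma>0$. A pair $(w,s)$ is a solution if $w,w_z,w_t,w_{zz}$ are continuous in $\{(z,t):0<z<s(t),\ t>0\}$ and all the conditions of the problem are satisfied. *)

(* Defs.v *)
From Stdlib Require Export Reals.
From Coquelicot Require Export Coquelicot.
Open Scope R_scope.

Definition erf (x : R) : R :=
  2 / sqrt PI * RInt (fun u => exp (- u ^ 2)) 0 x.

Definition is_right_derive (f : R -> R) (x l : R) : Prop :=
  filterlim (fun y => (f y - f x) / (y - x)) (at_right x) (locally l).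

Definition is_left_derive (f : R -> R) (x l : R) : Prop :=
  filterlim (fun y => (f y - f x) / (y - x)) (at_left x) (locally l).

(* Functions [w] of [(z, t)] are total; only their values on
   [0 <= z <= s t], [0 < t] are meaningful. *)
Definition inner_domain (s : R -> R) (p : R * R) : Prop :=
  0 < snd p /\ 0 < fst p < s (snd p).

Definition w_z (w : R -> R -> R) (z t : R) : R := Derive (fun x => w x t) z.
Definition w_zz (w : R -> R -> R) (z t : R) : R := Derive_n (fun x => w x t) 2 z.
Definition w_t (w : R -> R -> R) (z t : R) : R := Derive (fun r => w z r) t.

(* [Derive] is total, so existence of the derivatives is required separately. *)
Record regular (w : R -> R -> R) (s : R -> R) : Prop := {
  reg_ex_z : forall z t, inner_domain s (z, t) -> ex_derive (fun x => w x t) z;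
  reg_ex_zz : forall z t, inner_domain s (z, t) -> ex_derive_n (fun x => w x t) 2 z;
  reg_ex_t : forall z t, inner_domain s (z, t) -> ex_derive (fun r => w z r) t;
  reg_w : continuous_on (inner_domain s) (fun p => w (fst p) (snd p));
  reg_w_z : continuous_on (inner_domain s) (fun p => w_z w (fst p) (snd p));
  reg_w_t : continuous_on (inner_domain s) (fun p => w_t w (fst p) (snd p));
  reg_w_zz : continuous_on (inner_domain s) (fun p => w_zz w (fst p) (snd p))
}.

(* The derivatives [w_z (0, t)] and [w_z (s t, t)] at the two boundaries are the
   one-sided ones, taken from inside the domain. *)
Record is_solution (L0 v0 h0 wm0 eps : R) (w : R -> R -> R) (s : R -> R) : Prop := {
  sol_regular : regular w s;
  sol_s_pos : forall t, 0 < t -> 0 < s t;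
  sol_s_diff : forall t, 0 < t -> ex_derive s t;
  sol_heat : forall z t, inner_domain s (z, t) -> w_zz w z t = w_t w z t;
  sol_stefan : forall t, 0 < t ->
    is_left_derive (fun z => w z t) (s t) (- L0 * sqrt t * Derive s t);
  sol_front : forall t, 0 < t -> w (s t) t = 2 * wm0 * sqrt t;
  sol_fixed : forall t, 0 < t ->
    is_right_derive (fun z => w z t) 0
      (h0 / sqrt t * (eps * w 0 t - 2 * v0 * sqrt t));
  sol_s0 : s 0 = 0
}.

Definition similarity_form (w : R -> R -> R) (s : R -> R) : Prop :=
  exists (T : R -> R) (gamma : R),
    0 < gamma /\
    (forall t, 0 < t -> s t = 2 * gamma * sqrt t) /\
    (forall z t, 0 < t -> 0 <= z <= s t ->
       w z t = 2 * sqrt t * T (z / (2 * sqrt t))).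

Definition is_similarity_solution (L0 v0 h0 wm0 eps : R)
    (w : R -> R -> R) (s : R -> R) : Prop :=
  is_solution L0 v0 h0 wm0 eps w s /\ similarity_form w s.

Definition w_sim (L0 v0 h0 eps gamma : R) (z t : R) : R :=
  2 * sqrt t * (2 * h0 * v0 - L0 * gamma)
    / (sqrt PI * erf gamma + 2 * h0 * eps)
    * (exp (- (z ^ 2 / (4 * t)))
       + z * sqrt PI / (2 * sqrt t) * erf (z / (2 * sqrt t)))
  - z * ((2 * L0 * gamma * h0 * eps + 2 * h0 * v0 * sqrt PI * erf gamma)
         / (sqrt PI * erf gamma + 2 * h0 * eps)).

Definition s_sim (gamma : R) (t : R) : R := 2 * gamma * sqrt t.

Definition gamma_equation (L0 v0 h0 wm0 eps gamma : R) : Prop :=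
  (2 * v0 * h0 - L0 * gamma) * exp (- gamma ^ 2)
  = (wm0 + L0 * gamma ^ 2) * (sqrt PI * erf gamma + 2 * h0 * eps).

(* Main.v *)
(** Reading the profile off the slice [t = 1/4], where [2 * sqrt t = 1], turns
    the heat equation into [T'' = 2 T - 2 x T'] on [(0, gamma)].  Its solutions
    are the combinations [a x + b U x] with
    [U x = exp (- x^2) + sqrt PI * x * erf x].  The conditions at [x = 0] and the
    Stefan condition fix [a] and [b]; the remaining condition
    [T gamma = wm0] is then the equation for [gamma].  A root makes the left-hand
    side of that equation positive, and where it is positive it decreases while
    the right-hand side increases; hence there is only one root. *)

Require Import Defs.
From Stdlib Require Import Reals Lra.
From Coquelicot Require Import Coquelicot.
Open Scope R_scope.

(** * The error function without its normalisation, and its antiderivative *)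

Definition scaled_erf (x : R) : R := sqrt PI * erf x.

(** This is the solution [U] of the profile equation: the antiderivative of [scaled_erf] with value
    1 at 0. *)
Definition erf_profile (x : R) : R := exp (- x ^ 2) + x * scaled_erf x.

Lemma continuous_gauss (x : R) : continuous (fun u => exp (- u ^ 2)) x.
Proof.
  apply (@ex_derive_continuous R_AbsRing R_NormedModule).
  auto_derive; exact I.
Qed.

Lemma scaled_erf_RInt (x : R) :
  scaled_erf x = 2 * RInt (fun u => exp (- u ^ 2)) 0 x.
Proof.
  unfold scaled_erf, erf. field.
  apply Rgt_not_eq, sqrt_lt_R0, PI_RGT_0.
Qed.

Lemma is_derive_scaled_erf (x : R) :
  is_derive scaled_erf x (2 * exp (- x ^ 2)).
Proof.
  apply is_derive_ext with (fun y => scal 2 (RInt (fun u => exp (- u ^ 2)) 0 y)).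
  { intros y. now rewrite scaled_erf_RInt. }
  apply (is_derive_scal (RInt (fun u => exp (- u ^ 2)) 0) x 2).
  apply (is_derive_RInt (fun u => exp (- u ^ 2)) _ 0).
  - apply filter_forall; intros y.
    apply (@RInt_correct R_CompleteNormedModule).
    apply (@ex_RInt_continuous R_CompleteNormedModule).
    intros z _. apply continuous_gauss.
  - apply continuous_gauss.
Qed.

Lemma scaled_erf_0 : scaled_erf 0 = 0.
Proof.
  rewrite scaled_erf_RInt, RInt_point. unfold zero; simpl. ring.
Qed.

Lemma scaled_erf_lt (x y : R) : x < y -> scaled_erf x < scaled_erf y.
Proof.
  intros Hxy.
  refine (incr_function scaled_erf m_infty p_infty
            (fun u => 2 * exp (- u ^ 2)) _ _ x y I Hxy I).
  - intros u _ _. apply is_derive_scaled_erf.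
  - intros u _ _. apply Rmult_lt_0_compat; [lra | apply exp_pos].
Qed.

Lemma scaled_erf_pos (x : R) : 0 < x -> 0 < scaled_erf x.
Proof.
  intros Hx. rewrite <- scaled_erf_0. now apply scaled_erf_lt.
Qed.

(** The term [-2 x exp (-x^2)] from the exponential cancels against [x] times the derivative of
    [scaled_erf]. *)
Lemma is_derive_erf_profile (x : R) :
  is_derive erf_profile x (scaled_erf x).
Proof.
  unfold erf_profile. auto_derive.
  - eexists; apply is_derive_scaled_erf.
  - rewrite (is_derive_unique (fun u : R => scaled_erf u) _ _ (is_derive_scaled_erf x)).
    simpl. ring.
Qed.

Lemma continuous_scaled_erf (x : R) : continuous scaled_erf x.
Proof.
  apply (@ex_derive_continuous R_AbsRing R_NormedModule).
  eexists; apply is_derive_scaled_erf.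
Qed.

Lemma continuous_erf_profile (x : R) : continuous erf_profile x.
Proof.
  apply (@ex_derive_continuous R_AbsRing R_NormedModule).
  eexists; apply is_derive_erf_profile.
Qed.

(** * Difference quotients and one-sided derivatives *)

Lemma is_derive_quotient (f : R -> R) (x l : R) :
  is_derive f x l ->
  filterlim (fun y => (f y - f x) / (y - x)) (locally' x) (locally l).
Proof.
  intros Hf. apply is_derive_Reals in Hf.
  apply filterlim_locally; intros eps.
  destruct (Hf eps (cond_pos eps)) as [d Hd].
  exists d.
  change (forall y : R, Rabs (y - x) < d -> y <> x ->
            Rabs ((f y - f x) / (y - x) - l) < eps).
  intros y Hy Hyx.
  specialize (Hd (y - x)).
  replace (x + (y - x)) with y in Hd by ring.
  apply Hd; [lra | exact Hy].
Qed.

Lemma at_right_le_locally' (x : R) : filter_le (at_right x) (locally' x).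
Proof.
  intros P HP. unfold at_right, locally', within in *.
  revert HP; apply filter_imp; intros y Hy Hlt. apply Hy; lra.
Qed.

Lemma at_left_le_locally' (x : R) : filter_le (at_left x) (locally' x).
Proof.
  intros P HP. unfold at_left, locally', within in *.
  revert HP; apply filter_imp; intros y Hy Hlt. apply Hy; lra.
Qed.

Lemma is_derive_is_left_derive (f : R -> R) (x l : R) :
  is_derive f x l -> is_left_derive f x l.
Proof.
  intros Hf. apply (filterlim_filter_le_1 _ (at_left_le_locally' x)).
  now apply is_derive_quotient.
Qed.

Lemma is_derive_is_right_derive (f : R -> R) (x l : R) :
  is_derive f x l -> is_right_derive f x l.
Proof.
  intros Hf. apply (filterlim_filter_le_1 _ (at_right_le_locally' x)).
  now apply is_derive_quotient.
Qed.

(* A one-sided derivative forces one-sided continuity, so the values at [x]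
   agree as well and not only the slopes. *)
Lemma quotient_limit_agree (F : (R -> Prop) -> Prop) {FF : ProperFilter F}
    (f g : R -> R) (x l l' : R) :
  filter_le F (locally' x) ->
  F (fun y => f y = g y) ->
  filterlim (fun y => (f y - f x) / (y - x)) F (locally l) ->
  is_derive g x l' ->
  f x = g x /\ l = l'.
Proof.
  intros HF Hfg Hf Hg.
  assert (Hne : F (fun y => y <> x)).
  { apply HF. unfold locally', within. apply filter_forall; auto. }
  assert (Hloc : filter_le F (locally x)).
  { intros P HP. apply HF. unfold locally', within.
    revert HP; apply filter_imp; auto. }
  assert (Hfx : filterlim f F (locally (f x))).
  (* For [y <> x], [f y] is [f x] plus the quotient times [y - x], and along [F] this tends to
     [f x + l * 0]. *)
  { assert (H : filterlim
        (fun y => plus (f x) (mult ((f y - f x) / (y - x)) (plus y (opp x))))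
        F (locally (plus (f x) (mult l (plus x (opp x)))))).
    { eapply filterlim_comp_2;
        [apply filterlim_const | | apply (@filterlim_plus R_AbsRing R_NormedModule)].
      eapply filterlim_comp_2; [exact Hf | | apply (@filterlim_mult R_AbsRing)].
      eapply filterlim_comp_2;
        [exact Hloc | apply filterlim_const
        | apply (@filterlim_plus R_AbsRing R_NormedModule)]. }
    replace (plus (f x) (mult l (plus x (opp x)))) with (f x) in H
      by (unfold plus, mult, opp; simpl; ring).
    revert H; apply filterlim_ext_loc.
    revert Hne; apply filter_imp; intros y Hy.
    unfold plus, mult, opp; simpl. field. lra. }
  assert (Hgx : filterlim g F (locally (g x))).
  { apply (filterlim_filter_le_1 _ Hloc).
    apply (@ex_derive_continuous R_AbsRing R_NormedModule).
    eexists; exact Hg. }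
  assert (Heq : f x = g x).
  { apply (filterlim_locally_unique f _ _ Hfx).
    apply filterlim_ext_loc with g; [|exact Hgx].
    revert Hfg; apply filter_imp; auto. }
  split; [exact Heq|].
  apply (filterlim_locally_unique _ _ _ Hf).
  apply filterlim_ext_loc with (fun y => (g y - g x) / (y - x)).
  - revert Hfg; apply filter_imp; intros y Hy. now rewrite Hy, Heq.
  - apply (filterlim_filter_le_1 _ HF). now apply is_derive_quotient.
Qed.

(** * General solution of the profile equation *)

Lemma derive_zero_const (f : R -> R) (lo hi : R) :
  (forall x, lo < x < hi -> is_derive f x 0) ->
  forall x y, lo < x < hi -> lo < y < hi -> f x = f y.
Proof.
  intros Hf.
  assert (H : forall x y, lo < x < hi -> lo < y < hi -> x < y -> f x = f y).
  { intros x y Hx Hy Hxy. apply eq_is_derive; [|exact Hxy].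
    intros u Hu. apply Hf; lra. }
  intros x y Hx Hy. destruct (Rtotal_order x y) as [Hlt | [-> | Hlt]].
  - now apply H.
  - reflexivity.
  - symmetry; now apply H.
Qed.

(* The Wronskians of [T] with the two solutions [x] and [erf_profile x],
   multiplied by [exp (x^2)], are constant, and they determine [T]. *)
Lemma similarity_ode_solutions (T T1 T2 : R -> R) (lo hi : R) :
  lo < hi ->
  (forall x, lo < x < hi -> is_derive T x (T1 x)) ->
  (forall x, lo < x < hi -> is_derive T1 x (T2 x)) ->
  (forall x, lo < x < hi -> T2 x = 2 * T x - 2 * x * T1 x) ->
  exists a b, forall x, lo < x < hi -> T x = a * x + b * erf_profile x.
Proof.
  intros Hlohi HT HT1 Hode.
  (* By Abel's identity each Wronskian [W] satisfies [W' = -2 x W], so [exp (x^2)] is the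
     integrating factor. *)
  set (A := fun x => (T1 x * erf_profile x - T x * scaled_erf x) * exp (x ^ 2)).
  set (B := fun x => (T x - x * T1 x) * exp (x ^ 2)).
  assert (HA : forall x, lo < x < hi -> is_derive A x 0).
  { intros x Hx. unfold A. auto_derive.
    - exact (conj (ex_intro _ _ (HT1 x Hx))
              (conj (ex_intro _ _ (is_derive_erf_profile x))
              (conj (ex_intro _ _ (HT x Hx))
              (conj (ex_intro _ _ (is_derive_scaled_erf x)) I)))).
    - rewrite (is_derive_unique (fun u : R => T u) _ _ (HT x Hx)).
      rewrite (is_derive_unique (fun u : R => T1 u) _ _ (HT1 x Hx)).
      rewrite (is_derive_unique (fun u : R => scaled_erf u) _ _ (is_derive_scaled_erf x)).
      rewrite (is_derive_unique (fun u : R => erf_profile u) _ _ (is_derive_erf_profile x)).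
      rewrite (Hode x Hx). unfold erf_profile. simpl. ring. }
  assert (HB : forall x, lo < x < hi -> is_derive B x 0).
  { intros x Hx. unfold B. auto_derive.
    - exact (conj (ex_intro _ _ (HT x Hx)) (conj (ex_intro _ _ (HT1 x Hx)) I)).
    - rewrite (is_derive_unique (fun u : R => T u) _ _ (HT x Hx)).
      rewrite (is_derive_unique (fun u : R => T1 u) _ _ (HT1 x Hx)).
      rewrite (Hode x Hx). simpl. ring. }
  set (m := (lo + hi) / 2).
  assert (Hm : lo < m < hi) by (unfold m; lra).
  exists (A m), (B m). intros x Hx.
  rewrite (derive_zero_const A lo hi HA m x Hm Hx).
  rewrite (derive_zero_const B lo hi HB m x Hm Hx).
  assert (Hexp : exp (x ^ 2) * exp (- x ^ 2) = 1).
  { rewrite <- exp_plus, Rplus_opp_r. apply exp_0. }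
  (* The terms in [T1] cancel in [A x * x + B x * U x], leaving
     [exp (x^2) * T x * (U x - x * U' x)], and [U x - x * U' x = exp (-x^2)]. *)
  transitivity (T x * (exp (x ^ 2) * exp (- x ^ 2))).
  - rewrite Hexp. ring.
  - unfold A, B, erf_profile. ring.
Qed.

(** * Existence and uniqueness of the root [gamma] *)

(** Intermediate value theorem for right side minus left side. At 0 the difference is
    [2 h0 (wm0 eps - v0)], negative because [wm0 < v0]; at [2 v0 h0 / L0] the left side vanishes and
    the right side is positive. *)
Lemma gamma_root_exists (L0 v0 h0 wm0 eps : R) :
  0 < L0 -> 0 < v0 -> 0 < h0 -> 0 < wm0 -> wm0 < v0 ->
  eps = 0 \/ eps = 1 ->
  exists g, 0 < g /\ gamma_equation L0 v0 h0 wm0 eps g.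
Proof.
  intros HL Hv Hh Hw Hwv Heps.
  set (G := fun g => (wm0 + L0 * g ^ 2) * (scaled_erf g + 2 * h0 * eps)
                     - (2 * v0 * h0 - L0 * g) * exp (- g ^ 2)).
  assert (HG0 : G 0 < 0).
  { unfold G. rewrite scaled_erf_0.
    replace (- 0 ^ 2) with 0 by ring. rewrite exp_0.
    destruct Heps as [-> | ->]; nra. }
  set (g1 := 2 * v0 * h0 / L0).
  assert (Hg1 : 0 < g1).
  { unfold g1. apply Rdiv_lt_0_compat; nra. }
  assert (HG1 : 0 < G g1).
  { unfold G. replace (2 * v0 * h0 - L0 * g1) with 0 by (unfold g1; field; lra).
    rewrite Rmult_0_l, Rminus_0_r.
    pose proof (scaled_erf_pos g1 Hg1).
    apply Rmult_lt_0_compat; [nra | destruct Heps as [-> | ->]; nra]. }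
  assert (HGc : continuity G).
  { intros g. apply continuity_pt_filterlim.
    apply (@ex_derive_continuous R_AbsRing R_NormedModule).
    unfold G. auto_derive.
    eexists; apply is_derive_scaled_erf. }
  destruct (IVT G 0 g1 HGc Hg1 HG0 HG1) as [g [Hg HGg]].
  exists g. split.
  (* [IVT] only places [g] in the closed interval; [G 0 < 0] excludes [g = 0]. *)
  - destruct (Req_dec g 0) as [-> | Hne]; lra.
  - unfold gamma_equation. fold (scaled_erf g). unfold G in HGg. lra.
Qed.

Lemma gamma_root_unique (L0 v0 h0 wm0 eps g g' : R) :
  0 < L0 -> 0 < h0 -> 0 < wm0 -> 0 <= eps ->
  0 < g -> gamma_equation L0 v0 h0 wm0 eps g ->
  0 < g' -> gamma_equation L0 v0 h0 wm0 eps g' ->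
  g = g'.
Proof.
  intros HL Hh Hw Heps.
  assert (Hno : forall g g', 0 < g -> gamma_equation L0 v0 h0 wm0 eps g ->
    gamma_equation L0 v0 h0 wm0 eps g' -> g < g' -> False).
  { clear g g'. intros g g' Hg Eg Eg' Hlt.
    unfold gamma_equation in *.
    fold (scaled_erf g) in Eg. fold (scaled_erf g') in Eg'.
    pose proof (scaled_erf_pos g Hg) as Hpos.
    pose proof (scaled_erf_lt g g' Hlt) as Hinc.
    assert (Hhe : 0 <= 2 * h0 * eps) by nra.
    assert (Hsq : g ^ 2 < g' ^ 2) by nra.
    pose proof (exp_pos (- g' ^ 2)) as He'.
    assert (He : exp (- g' ^ 2) < exp (- g ^ 2)) by (apply exp_increasing; lra).
    assert (Hr : 0 < (wm0 + L0 * g ^ 2) * (scaled_erf g + 2 * h0 * eps))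
      by (apply Rmult_lt_0_compat; nra).
    assert (Hr' : (wm0 + L0 * g ^ 2) * (scaled_erf g + 2 * h0 * eps)
                  < (wm0 + L0 * g' ^ 2) * (scaled_erf g' + 2 * h0 * eps)).
    { apply Rmult_le_0_lt_compat; nra. }
    (* The right side is positive at [g'], so the equation there makes the linear factor positive;
       only then can the two decreasing factors on the left be multiplied. *)
    assert (Hl' : 0 < 2 * v0 * h0 - L0 * g').
    { apply Rmult_lt_reg_r with (exp (- g' ^ 2)); [exact He' | lra]. }
    assert (Hl : (2 * v0 * h0 - L0 * g') * exp (- g' ^ 2)
                 < (2 * v0 * h0 - L0 * g) * exp (- g ^ 2)).
    { apply Rmult_le_0_lt_compat; nra. }
    lra. }
  intros Hg Eg Hg' Eg'.
  destruct (Rtotal_order g g') as [H | [H | H]]; trivial; exfalso; eauto.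
Qed.

(** * Boundary conditions as an algebraic system for the profile coefficients *)

(** The coefficient of [x]; it is the slope of the profile at 0 because [scaled_erf 0 = 0]. *)
Definition profile_slope (L0 v0 h0 eps g : R) : R :=
  - ((2 * L0 * g * h0 * eps + 2 * h0 * v0 * scaled_erf g)
     / (scaled_erf g + 2 * h0 * eps)).

(** The coefficient of [erf_profile]; it is the value of the profile at 0 because
    [erf_profile 0 = 1]. *)
Definition profile_value (L0 v0 h0 eps g : R) : R :=
  (2 * h0 * v0 - L0 * g) / (scaled_erf g + 2 * h0 * eps).

(** The left side lists the flux condition at 0, the Stefan condition and the front condition for
    [a x + b U x]. The first two are linear in [a] and [b]; eliminating [a] gives
    [b D = 2 h0 v0 - L0 g] with [D > 0]. Existence uses the equivalence from right to left,
    uniqueness from left to right. *)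
Lemma boundary_conditions_iff (L0 v0 h0 wm0 eps g a b : R) :
  0 < scaled_erf g + 2 * h0 * eps ->
  (a = 2 * h0 * (eps * b - v0) /\
   a + b * scaled_erf g = - L0 * g /\
   a * g + b * erf_profile g = wm0)
  <-> (a = profile_slope L0 v0 h0 eps g /\
       b = profile_value L0 v0 h0 eps g /\
       gamma_equation L0 v0 h0 wm0 eps g).
Proof.
  intros HD.
  unfold gamma_equation. fold (scaled_erf g).
  set (D := scaled_erf g + 2 * h0 * eps) in *.
  unfold erf_profile, profile_slope, profile_value. fold D.
  split.
  - intros [H1 [H2 H3]].
    assert (HbD : b * D = 2 * h0 * v0 - L0 * g) by (unfold D; lra).
    assert (Hb : b = (2 * h0 * v0 - L0 * g) / D).
    { rewrite <- HbD. field. lra. }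
    split; [|split]; [|exact Hb|].
    + rewrite H1, Hb. unfold D in *. field. lra.
    + replace (2 * v0 * h0 - L0 * g) with (b * D) by lra.
      (* Subtracting [g] times the Stefan condition from the front condition leaves
         [b exp (-g^2) = wm0 + L0 g^2]. *)
      replace (wm0 + L0 * g ^ 2) with (b * exp (- g ^ 2)); [ring|].
      rewrite <- H3.
      replace (L0 * g ^ 2) with (- g * (- L0 * g)) by ring.
      rewrite <- H2. ring.
  - intros [Ha [Hb Hg]].
    assert (Ha' : a = 2 * h0 * (eps * b - v0)).
    { rewrite Ha, Hb. unfold D in *. field. lra. }
    assert (H2 : a + b * scaled_erf g = - L0 * g).
    { rewrite Ha', Hb. unfold D in *. field. lra. }
    split; [exact Ha' | split; [exact H2|]].
    replace (a * g + b * (exp (- g ^ 2) + g * scaled_erf g))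
      with (g * (a + b * scaled_erf g) + b * exp (- g ^ 2)) by ring.
    rewrite H2, Hb.
    replace ((2 * h0 * v0 - L0 * g) / D * exp (- g ^ 2))
      with ((2 * v0 * h0 - L0 * g) * exp (- g ^ 2) / D) by (field; lra).
    rewrite Hg. field. lra.
Qed.

(** * Explicit similarity functions and their partial derivatives *)

Definition similarity_fun (a b z t : R) : R :=
  2 * sqrt t * (a * (z / (2 * sqrt t)) + b * erf_profile (z / (2 * sqrt t))).

Lemma sqr_similarity_variable (z t : R) :
  0 < t -> (z / (2 * sqrt t)) ^ 2 = z ^ 2 / (4 * t).
Proof.
  intros Ht. pose proof (sqrt_lt_R0 t Ht).
  rewrite <- (sqrt_sqrt t) at 2 by lra. field. lra.
Qed.

Lemma w_sim_similarity_fun (L0 v0 h0 eps g z t : R) :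
  0 < t ->
  w_sim L0 v0 h0 eps g z t
  = similarity_fun (profile_slope L0 v0 h0 eps g) (profile_value L0 v0 h0 eps g) z t.
Proof.
  intros Ht. pose proof (sqrt_lt_R0 t Ht) as Hs.
  unfold w_sim, similarity_fun, erf_profile.
  rewrite (sqr_similarity_variable z t Ht).
  unfold profile_slope, profile_value, scaled_erf, Rdiv.
  (* Naming this inverse makes it an atom for [field], which then asks for no nonvanishing of the
     denominator. *)
  set (i := / (sqrt PI * erf g + 2 * h0 * eps)).
  set (E := erf (z * / (2 * sqrt t))).
  replace (2 * h0 * v0 * sqrt PI * erf g) with (2 * h0 * v0 * (sqrt PI * erf g)) by ring.
  field. lra.
Qed.

Lemma is_derive_similarity_fun_z (a b z t : R) :
  0 < t ->
  is_derive (fun x => similarity_fun a b x t) z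
    (a + b * scaled_erf (z / (2 * sqrt t))).
Proof.
  intros Ht. pose proof (sqrt_lt_R0 t Ht) as Hs.
  unfold similarity_fun. auto_derive.
  - eexists; apply is_derive_erf_profile.
  - rewrite (is_derive_unique (fun u : R => erf_profile u) _ _ (is_derive_erf_profile _)).
    unfold Rdiv. field. lra.
Qed.

Lemma is_derive_similarity_fun_zz (a b z t : R) :
  0 < t ->
  is_derive (fun x => a + b * scaled_erf (x / (2 * sqrt t))) z
    (b * exp (- (z / (2 * sqrt t)) ^ 2) / sqrt t).
Proof.
  intros Ht. pose proof (sqrt_lt_R0 t Ht) as Hs.
  auto_derive.
  - eexists; apply is_derive_scaled_erf.
  - rewrite (is_derive_unique (fun u : R => scaled_erf u) _ _ (is_derive_scaled_erf _)).
    unfold Rdiv. field. lra.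
Qed.

(** Chain rule, with [z / (2 sqrt t)] having time derivative [- z / (2 sqrt t) / (2 t)]. The profile
    is arbitrary so that the lemma also applies to the unknown profile in the uniqueness proof. *)
Lemma is_derive_similarity_form_t (T : R -> R) (z t l : R) :
  0 < t ->
  is_derive T (z / (2 * sqrt t)) l ->
  is_derive (fun r => 2 * sqrt r * T (z / (2 * sqrt r))) t
    ((T (z / (2 * sqrt t)) - z / (2 * sqrt t) * l) / sqrt t).
Proof.
  intros Ht HT. pose proof (sqrt_lt_R0 t Ht) as Hs.
  auto_derive.
  - refine (conj _ (conj (ex_intro _ _ HT) (conj _ (conj _ I)))); trivial; lra.
  - rewrite (is_derive_unique (fun u : R => T u) (z * / (2 * sqrt t)) l HT).
    unfold Rdiv. field. lra.
Qed.

(** The linear part drops out of [T - x T'], and [U x - x * U' x = exp (-x^2)]. The value is the one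
    in [is_derive_similarity_fun_zz], which is the heat equation. *)
Lemma is_derive_similarity_fun_t (a b z t : R) :
  0 < t ->
  is_derive (fun r => similarity_fun a b z r) t
    (b * exp (- (z / (2 * sqrt t)) ^ 2) / sqrt t).
Proof.
  intros Ht. unfold similarity_fun.
  set (x := z / (2 * sqrt t)).
  assert (HT : is_derive (fun x => a * x + b * erf_profile x) x
                 (a + b * scaled_erf x)).
  { auto_derive.
    - eexists; apply is_derive_erf_profile.
    - rewrite (is_derive_unique (fun u : R => erf_profile u) _ _ (is_derive_erf_profile _)).
      ring. }
  pose proof (is_derive_similarity_form_t _ z t _ Ht HT) as H.
  fold x in H.
  replace (b * exp (- x ^ 2) / sqrt t)
    with ((a * x + b * erf_profile x - x * (a + b * scaled_erf x)) / sqrt t).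
  - exact H.
  - unfold erf_profile, Rdiv. ring.
Qed.

(** * Joint continuity in [(z, t)] *)

Lemma continuous_sqrt_snd (p : R * R) :
  0 < snd p -> continuous (fun q : R * R => sqrt (snd q)) p.
Proof.
  intros Hp.
  apply (continuous_comp (fun q : R * R => snd q) sqrt).
  - apply continuous_snd.
  - apply (@ex_derive_continuous R_AbsRing R_NormedModule).
    auto_derive; trivial.
Qed.

Lemma continuous_inv_sqrt_snd (p : R * R) :
  0 < snd p -> continuous (fun q : R * R => / sqrt (snd q)) p.
Proof.
  intros Hp.
  apply (continuous_comp (fun q : R * R => snd q) (fun t => / sqrt t)).
  - apply continuous_snd.
  - apply (@ex_derive_continuous R_AbsRing R_NormedModule).
    auto_derive; refine (conj _ (conj _ I)); trivial.
    apply Rgt_not_eq, sqrt_lt_R0, Hp.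
Qed.

Lemma continuous_similarity_variable (p : R * R) :
  0 < snd p ->
  continuous (fun q : R * R => fst q / (2 * sqrt (snd q))) p.
Proof.
  intros Hp.
  apply continuous_ext with (fun q : R * R => mult (fst q) (scal (/ 2) (/ sqrt (snd q)))).
  { intros q. unfold mult, scal; simpl. unfold mult; simpl.
    unfold Rdiv. now rewrite Rinv_mult. }
  apply (@continuous_mult _ R_AbsRing).
  - apply continuous_fst.
  - apply (@continuous_scal_r _ R_AbsRing R_NormedModule).
    now apply continuous_inv_sqrt_snd.
Qed.

Lemma continuous_on_of_ext (D : R * R -> Prop) (f g : R * R -> R) :
  (forall p, D p -> f p = g p) ->
  (forall p, D p -> continuous g p) ->
  continuous_on D f.
Proof.
  intros Hfg Hg. apply continuous_on_ext with g.
  - intros p Hp. symmetry. now apply Hfg.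
  - intros p Hp. apply (filterlim_filter_le_1 _ (filter_le_within D)).
    apply Hg, Hp.
Qed.

(** * Regularity of functions given by the explicit formula *)

Section Existence.

Variables (w : R -> R -> R) (s : R -> R) (a b : R).
(** The formula is assumed for every real [z], also beyond the two boundaries, so that two-sided
    derivatives exist there and yield the one-sided ones. *)
Hypothesis w_eq : forall z t, 0 < t -> w z t = similarity_fun a b z t.

Lemma is_derive_w_z (z t : R) :
  0 < t ->
  is_derive (fun x => w x t) z (a + b * scaled_erf (z / (2 * sqrt t))).
Proof.
  intros Ht. apply is_derive_ext with (fun x => similarity_fun a b x t).
  - intros x. symmetry. now apply w_eq.
  - now apply is_derive_similarity_fun_z.
Qed.

Lemma is_derive_w_zz (z t : R) :
  0 < t ->
  is_derive (Derive (fun x => w x t)) z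
    (b * exp (- (z / (2 * sqrt t)) ^ 2) / sqrt t).
Proof.
  intros Ht.
  apply is_derive_ext with (fun x => a + b * scaled_erf (x / (2 * sqrt t))).
  - intros x. symmetry. apply is_derive_unique. now apply is_derive_w_z.
  - now apply is_derive_similarity_fun_zz.
Qed.

Lemma is_derive_w_t (z t : R) :
  0 < t ->
  is_derive (fun r => w z r) t
    (b * exp (- (z / (2 * sqrt t)) ^ 2) / sqrt t).
Proof.
  intros Ht. apply is_derive_ext_loc with (fun r => similarity_fun a b z r).
  - apply (filter_imp (fun r => 0 < r)).
    + intros r Hr. symmetry. now apply w_eq.
    + now apply (open_gt 0).
  - now apply is_derive_similarity_fun_t.
Qed.

Lemma continuous_w_zz_formula (p : R * R) :
  0 < snd p ->
  continuous (fun q : R * R =>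
    b * exp (- (fst q / (2 * sqrt (snd q))) ^ 2) / sqrt (snd q)) p.
Proof.
  intros Hp.
  apply (@continuous_mult _ R_AbsRing).
  - apply (@continuous_scal_r _ R_AbsRing R_NormedModule).
    apply (continuous_comp (fun q : R * R => fst q / (2 * sqrt (snd q)))
             (fun x => exp (- x ^ 2))).
    + now apply continuous_similarity_variable.
    + apply continuous_gauss.
  - now apply continuous_inv_sqrt_snd.
Qed.

Lemma regular_similarity_fun : regular w s.
Proof.
  split.
  - intros z t [Ht _]. eexists. now apply is_derive_w_z.
  - intros z t [Ht _]. eexists. now apply is_derive_w_zz.
  - intros z t [Ht _]. eexists. now apply is_derive_w_t.
  - apply continuous_on_of_ext with
      (fun p => similarity_fun a b (fst p) (snd p)).
    + intros p [Hp _]. now apply w_eq.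
    + intros p [Hp _]. unfold similarity_fun.
      apply (@continuous_mult _ R_AbsRing).
      * apply (@continuous_scal_r _ R_AbsRing R_NormedModule).
        now apply continuous_sqrt_snd.
      * apply (@continuous_plus _ R_AbsRing R_NormedModule);
          apply (@continuous_scal_r _ R_AbsRing R_NormedModule).
        -- now apply continuous_similarity_variable.
        -- apply (continuous_comp (fun q : R * R => fst q / (2 * sqrt (snd q)))
                    erf_profile).
           ++ now apply continuous_similarity_variable.
           ++ apply continuous_erf_profile.
  - apply continuous_on_of_ext with
      (fun p => a + b * scaled_erf (fst p / (2 * sqrt (snd p)))).
    + intros p [Hp _]. apply is_derive_unique. now apply is_derive_w_z.
    + intros p [Hp _].
      apply (@continuous_plus _ R_AbsRing R_NormedModule).
      * apply continuous_const.
      * apply (@continuous_scal_r _ R_AbsRing R_NormedModule).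
        apply (continuous_comp (fun q : R * R => fst q / (2 * sqrt (snd q)))
                 scaled_erf).
        -- now apply continuous_similarity_variable.
        -- apply continuous_scaled_erf.
  - apply continuous_on_of_ext with
      (fun p => b * exp (- (fst p / (2 * sqrt (snd p))) ^ 2) / sqrt (snd p)).
    + intros p [Hp _]. apply is_derive_unique. now apply is_derive_w_t.
    + intros p [Hp _]. now apply continuous_w_zz_formula.
  - apply continuous_on_of_ext with
      (fun p => b * exp (- (fst p / (2 * sqrt (snd p))) ^ 2) / sqrt (snd p)).
    + intros p [Hp _]. apply is_derive_unique. now apply is_derive_w_zz.
    + intros p [Hp _]. now apply continuous_w_zz_formula.
Qed.

End Existence.

(** * The explicit pair is a similarity solution *)

Lemma is_derive_s_sim (g t : R) :
  0 < t -> is_derive (s_sim g) t (g / sqrt t).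
Proof.
  intros Ht. pose proof (sqrt_lt_R0 t Ht).
  unfold s_sim. auto_derive; [trivial|]. field. lra.
Qed.

Lemma similarity_solution_exists (L0 v0 h0 wm0 eps g : R) :
  0 < h0 -> 0 <= eps -> 0 < g -> gamma_equation L0 v0 h0 wm0 eps g ->
  is_similarity_solution L0 v0 h0 wm0 eps (w_sim L0 v0 h0 eps g) (s_sim g).
Proof.
  intros Hh Heps Hg Eg.
  assert (HD : 0 < scaled_erf g + 2 * h0 * eps).
  { pose proof (scaled_erf_pos g Hg). nra. }
  set (a := profile_slope L0 v0 h0 eps g).
  set (b := profile_value L0 v0 h0 eps g).
  destruct (proj2 (boundary_conditions_iff L0 v0 h0 wm0 eps g a b HD)
              (conj eq_refl (conj eq_refl Eg))) as [H1 [H2 H3]].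
  set (w := w_sim L0 v0 h0 eps g).
  assert (Hw : forall z t, 0 < t -> w z t = similarity_fun a b z t).
  { intros z t Ht. now apply w_sim_similarity_fun. }
  assert (Hfront : forall t, 0 < t -> s_sim g t / (2 * sqrt t) = g).
  { intros t Ht. pose proof (sqrt_lt_R0 t Ht). unfold s_sim. field. lra. }
  split; [split|].
  - now apply regular_similarity_fun with a b.
  - intros t Ht. pose proof (sqrt_lt_R0 t Ht). unfold s_sim. nra.
  - intros t Ht. eexists. now apply is_derive_s_sim.
  - intros z t [Ht _]. simpl in Ht.
    transitivity (b * exp (- (z / (2 * sqrt t)) ^ 2) / sqrt t).
    + apply is_derive_unique. now apply (is_derive_w_zz w a b Hw).
    + symmetry. apply is_derive_unique. now apply (is_derive_w_t w a b Hw).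
  - intros t Ht. pose proof (sqrt_lt_R0 t Ht).
    apply is_derive_is_left_derive.
    rewrite (is_derive_unique _ _ _ (is_derive_s_sim g t Ht)).
    (* The time dependence cancels, and the Stefan condition becomes the second boundary equation
       [H2]. *)
    replace (- L0 * sqrt t * (g / sqrt t)) with (- L0 * g) by (field; lra).
    replace (- L0 * g) with (a + b * scaled_erf (s_sim g t / (2 * sqrt t)))
      by now rewrite (Hfront t Ht).
    now apply (is_derive_w_z w a b Hw).
  - intros t Ht. rewrite (Hw _ _ Ht). unfold similarity_fun.
    rewrite (Hfront t Ht), H3. ring.
  - intros t Ht. pose proof (sqrt_lt_R0 t Ht).
    apply is_derive_is_right_derive.
    replace (h0 / sqrt t * (eps * w 0 t - 2 * v0 * sqrt t))
      with (a + b * scaled_erf (0 / (2 * sqrt t))).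
    { now apply (is_derive_w_z w a b Hw). }
    (* Since [w 0 t = 2 b sqrt t], the flux condition reduces to the first boundary equation
       [H1]. *)
    rewrite (Hw _ _ Ht). unfold similarity_fun, erf_profile.
    replace (0 / (2 * sqrt t)) with 0 by (field; lra).
    rewrite scaled_erf_0. replace (- 0 ^ 2) with 0 by ring. rewrite exp_0.
    rewrite H1. field. lra.
  - unfold s_sim. rewrite sqrt_0. ring.
  - exists (fun x => a * x + b * erf_profile x), g.
    split; [exact Hg | split; [reflexivity|]].
    intros z t Ht _. now apply Hw.
Qed.

(** * Every similarity solution is the explicit one *)

Lemma sqrt_quarter : sqrt (1 / 4) = 1 / 2.
Proof.
  replace (1 / 4) with ((1 / 2) * (1 / 2)) by field.
  apply sqrt_square. lra.
Qed.

(** At [t = 1/4] the similarity variable is [z] itself, so the slice equals [T] on [[0, g]].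
    Replacing the arbitrary [T] by the slice gives a profile whose differentiability comes directly
    from that of [w]. *)
Lemma similarity_slice (w : R -> R -> R) (s T : R -> R) (g : R) :
  (forall t, 0 < t -> s t = 2 * g * sqrt t) ->
  (forall z t, 0 < t -> 0 <= z <= s t ->
     w z t = 2 * sqrt t * T (z / (2 * sqrt t))) ->
  forall z t, 0 < t -> 0 <= z <= s t ->
    w z t = 2 * sqrt t * w (z / (2 * sqrt t)) (1 / 4).
Proof.
  intros Hs HT z t Ht Hz. pose proof (sqrt_lt_R0 t Ht) as Hst.
  rewrite (HT z t Ht Hz). rewrite (HT _ (1 / 4)); [|lra|].
  - rewrite sqrt_quarter. f_equal.
    replace (2 * (1 / 2)) with 1 by field.
    rewrite Rmult_1_l. unfold Rdiv at 2. now rewrite Rinv_1, Rmult_1_r.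
  - rewrite (Hs (1 / 4)), sqrt_quarter by lra.
    rewrite (Hs t Ht) in Hz. split.
    + apply Rmult_le_pos; [lra|].
      left; apply Rinv_0_lt_compat; lra.
    + apply Rmult_le_reg_r with (2 * sqrt t); [lra|].
      unfold Rdiv. rewrite Rmult_assoc, Rinv_l by lra. lra.
Qed.

Lemma similarity_solution_determined (L0 v0 h0 wm0 eps : R)
    (w : R -> R -> R) (s : R -> R) :
  0 < h0 -> 0 <= eps ->
  is_similarity_solution L0 v0 h0 wm0 eps w s ->
  exists g, 0 < g /\ gamma_equation L0 v0 h0 wm0 eps g /\
    (forall t, 0 <= t -> s t = s_sim g t) /\
    (forall z t, 0 < t -> 0 <= z <= s t -> w z t = w_sim L0 v0 h0 eps g z t).
Proof.
  intros Hh Heps [Hsol [T0 [g [Hg [Hs HT0]]]]].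
  pose proof (similarity_slice w s T0 g Hs HT0) as HT. clear T0 HT0.
  set (T := fun x => w x (1 / 4)).
  assert (Hq : 0 < 1 / 4) by lra.
  assert (Hsq : s (1 / 4) = g) by (rewrite Hs, sqrt_quarter by lra; field).
  assert (Hdom : forall x, 0 < x < g -> inner_domain s (x, 1 / 4)).
  { intros x Hx. split; simpl; [lra | now rewrite Hsq]. }
  destruct Hsol as [Hreg _ _ Hheat Hstefan Hfr Hfix Hs0].
  assert (HT1 : forall x, 0 < x < g -> is_derive T x (Derive T x)).
  { intros x Hx. apply Derive_correct. apply (reg_ex_z _ _ Hreg), Hdom, Hx. }
  assert (HT2 : forall x, 0 < x < g -> is_derive (Derive T) x (Derive (Derive T) x)).
  { intros x Hx. apply Derive_correct. apply (reg_ex_zz _ _ Hreg _ _ (Hdom x Hx)). }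
  assert (Hode : forall x, 0 < x < g ->
            Derive (Derive T) x = 2 * T x - 2 * x * Derive T x).
  { intros x Hx.
    change (Derive (Derive T) x) with (w_zz w x (1 / 4)).
    rewrite (Hheat _ _ (Hdom x Hx)).
    assert (Hx1 : x / (2 * sqrt (1 / 4)) = x) by (rewrite sqrt_quarter; field).
    pose proof (is_derive_similarity_form_t T x (1 / 4) (Derive T x) Hq) as Ht.
    rewrite Hx1 in Ht. specialize (Ht (HT1 x Hx)).
    unfold w_t. rewrite sqrt_quarter in Ht.
    replace (2 * T x - 2 * x * Derive T x)
      with ((T x - x * Derive T x) / (1 / 2)) by field.
    apply is_derive_unique. revert Ht. apply is_derive_ext_loc.
    (* The similarity form holds at [(x, r)] only while [x <= s r]; the condition
       [x / (2 g) < sqrt r] ensures this and is open around [r = 1/4]. *)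
    apply (filter_imp (fun r => 0 < r /\ x / (2 * g) < sqrt r)).
    - intros r [Hr Hxr]. symmetry. apply HT; [exact Hr|].
      rewrite (Hs r Hr). split; [lra|].
      apply (Rmult_lt_compat_r (2 * g)) in Hxr; [|lra].
      unfold Rdiv in Hxr. rewrite Rmult_assoc, Rinv_l in Hxr by lra. lra.
    - apply filter_and.
      + now apply (open_gt 0).
      + apply (continuous_sqrt (1 / 4) (fun u => x / (2 * g) < u)).
        apply (open_gt (x / (2 * g))). rewrite sqrt_quarter.
        apply Rmult_lt_reg_r with (2 * g); [lra|].
        unfold Rdiv. rewrite Rmult_assoc, Rinv_l by lra. lra. }
  destruct (similarity_ode_solutions T _ _ 0 g Hg HT1 HT2 Hode) as [a [b HTab]].
  set (F := fun x => a * x + b * erf_profile x).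
  assert (HF : forall x, is_derive F x (a + b * scaled_erf x)).
  { intros x. unfold F. auto_derive.
    - eexists; apply is_derive_erf_profile.
    - rewrite (is_derive_unique (fun u : R => erf_profile u) _ _ (is_derive_erf_profile _)).
      ring. }
  (* [T = F] is known only in the open interval. At each end the prescribed one-sided derivative of
     [T] forces equality of the values and turns the boundary condition into an equation for [a] and
     [b]. *)
  destruct (quotient_limit_agree (at_right 0) T F 0 _ _
              (at_right_le_locally' 0)
              (filter_imp _ _ (fun x (Hx : x < g) (H0 : 0 < x) => HTab x (conj H0 Hx))
                 (open_lt g 0 Hg))
              (Hfix _ Hq) (HF 0)) as [HF0 Hslope0].
  assert (Hst : is_left_derive T g (- L0 * g)).
  { specialize (Hstefan _ Hq). rewrite Hsq in Hstefan.
    assert (Hds : Derive s (1 / 4) = 2 * g).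
    { apply is_derive_unique.
      apply is_derive_ext_loc with (s_sim g).
      - apply (filter_imp (fun r => 0 < r)).
        + intros r Hr. symmetry. now apply Hs.
        + now apply (open_gt 0).
      - replace (2 * g) with (g / sqrt (1 / 4)) by (rewrite sqrt_quarter; field).
        now apply is_derive_s_sim. }
    rewrite Hds, sqrt_quarter in Hstefan.
    replace (- L0 * g) with (- L0 * (1 / 2) * (2 * g)) by field.
    exact Hstefan. }
  destruct (quotient_limit_agree (at_left g) T F g _ _
              (at_left_le_locally' g)
              (filter_imp _ _ (fun x (Hx : 0 < x) (H0 : x < g) => HTab x (conj Hx H0))
                 (open_gt 0 g Hg))
              Hst (HF g)) as [HFg Hslopeg].
  assert (HD : 0 < scaled_erf g + 2 * h0 * eps).
  { pose proof (scaled_erf_pos g Hg). nra. }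
  assert (HTF : forall x, 0 <= x <= g -> T x = F x).
  { intros x Hx. destruct (Req_dec x 0) as [-> | Hx0]; [exact HF0|].
    destruct (Req_dec x g) as [-> | Hxg]; [exact HFg|].
    apply HTab; lra. }
  assert (Hbc : a = 2 * h0 * (eps * b - v0) /\
                a + b * scaled_erf g = - L0 * g /\
                a * g + b * erf_profile g = wm0).
  { split; [|split].
    - fold (T 0) in Hslope0. rewrite HF0, sqrt_quarter, scaled_erf_0 in Hslope0.
      unfold F, erf_profile in Hslope0.
      rewrite scaled_erf_0 in Hslope0.
      replace (- 0 ^ 2) with 0 in Hslope0 by ring. rewrite exp_0 in Hslope0.
      lra.
    - symmetry. exact Hslopeg.
    - fold (F g). rewrite <- HFg. unfold T.
      specialize (Hfr _ Hq). rewrite Hsq, sqrt_quarter in Hfr. lra. }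
  apply boundary_conditions_iff in Hbc; [|exact HD].
  destruct Hbc as [Ha [Hb Eg]].
  exists g. split; [exact Hg | split; [exact Eg | split]].
  - intros t [Ht | <-].
    + now apply Hs.
    + rewrite Hs0. unfold s_sim. rewrite sqrt_0. ring.
  - intros z t Ht Hz. pose proof (sqrt_lt_R0 t Ht) as Hst'.
    rewrite (w_sim_similarity_fun _ _ _ _ _ _ _ Ht), <- Ha, <- Hb.
    (* Scaling carries the formula from the slice to time [t], as [z / (2 sqrt t)] lies in
       [[0, g]]. *)
    rewrite (HT z t Ht Hz). unfold similarity_fun. f_equal.
    apply HTF. rewrite (Hs t Ht) in Hz. split.
    + apply Rmult_le_pos; [lra|]. left; apply Rinv_0_lt_compat; lra.
    + apply Rmult_le_reg_r with (2 * sqrt t); [lra|].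
      unfold Rdiv. rewrite Rmult_assoc, Rinv_l by lra. lra.
Qed.

(** Uniqueness is agreement for [0 <= t] and on the closed region [0 <= z <= s t], [0 < t], because
    the total functions [w] and [s] may take any values elsewhere. *)
Theorem theorem3p2 :
  forall (L0 v0 h0 wm0 eps : R),
    0 < L0 -> 0 < v0 -> 0 < h0 -> 0 < wm0 -> wm0 < v0 ->
    eps = 0 \/ eps = 1 ->
    exists gamma : R,
      unique (fun g => 0 < g /\ gamma_equation L0 v0 h0 wm0 eps g) gamma /\
      is_similarity_solution L0 v0 h0 wm0 eps
        (w_sim L0 v0 h0 eps gamma) (s_sim gamma) /\
      (forall (w : R -> R -> R) (s : R -> R),
         is_similarity_solution L0 v0 h0 wm0 eps w s ->
         (forall t, 0 <= t -> s t = s_sim gamma t) /\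
         (forall z t, 0 < t -> 0 <= z <= s t ->
            w z t = w_sim L0 v0 h0 eps gamma z t)).
Proof.
  intros L0 v0 h0 wm0 eps HL Hv Hh Hw Hwv Heps.
  assert (Heps0 : 0 <= eps) by (destruct Heps; lra).
  destruct (gamma_root_exists L0 v0 h0 wm0 eps HL Hv Hh Hw Hwv Heps) as [g [Hg Eg]].
  exists g. split; [|split].
  - split; [now split|]. intros g' [Hg' Eg'].
    now apply gamma_root_unique with L0 v0 h0 wm0 eps.
  - now apply similarity_solution_exists.
  - intros w s Hsol.
    destruct (similarity_solution_determined L0 v0 h0 wm0 eps w s Hh Heps0 Hsol)
      as [g' [Hg' [Eg' H]]].
    (* The front constant of the given solution is itself a root, hence equal to [g]. *)
    now rewrite (gamma_root_unique L0 v0 h0 wm0 eps g g').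
Qed.
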